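(* Let $\mathfrak{I}$ be a loopblind boolean interaction family that is functionally representable and contraction-closed. Let $\mathcal{M}=\mathcal{M}(G;\mathfrak{I})$ be the hypergraphical model induced by $\mathfrak{I}$ on a loopless hypergraph $G=(V,E)$, and let $e\in E$ with decomposition $e=I\sqcup D$ and dependency map $\sigma$. Then for $\boldsymbol{g}\in\mathbb{C}^{E}$, $$Z(\mathcal{M};\boldsymbol{g})=Z(\mathcal{M}\setminus e;\boldsymbol{g}')+v_e\,Z(\mathcal{M}/_{\mathfrak{I},\sigma}e;\boldsymbol{g}'),$$ where $v_e=\exp(g_e)-1$ and $\boldsymbol{g}'=(g_f)_{f\in E\setminus\{e\}}$.
   Context: Hypergraphs. A hypergraph $G=(V,E)$ has a finite vertex set $V$ and a finite multiset $E$ of hyperedges, each a finite multiset of elements of $V$ (empty hyperedges allowed; repeated hyperedges count as distinct elements of $E$). $G$ is loopless if every hyperedge is a set. Interaction families. A boolean interaction family $\mathfrak{I}=(S,\{\Phi^k\}_{k\ge0})$ is a finite set $S$, $q=|S|\ge2$, with permutation-invariant functions $\Phi^k\colon S^k\to\{0,1\}$; for a finite (multi)set $A$ of indices, $\Phi^{|A|}(\boldsymbol{s}|_A)$ is $\Phi^{|A|}$ applied to the entries $s_i$, $i\in A$ (with multiplicity). Put $K_{\Phi^k}=\{\boldsymbol{s}\in S^k\mid\Phi^k(\boldsymbol{s})=1\}$. The induced model $\mathcal{M}(G;\mathfrak{I})$ has interaction functions $\phi^e(\boldsymbol{s})=\Phi^{|e|}(\boldsymbol{s}|_e)$, $\boldsymbol{s}\in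 S^V$, $e\in E$, and partition function $Z(\mathcal{M};\boldsymbol{g})=\sum_{\boldsymbol{s}\in S^V}\prod_{e\in E}\exp(g_e\phi^e(\boldsymbol{s}))$. Loopblind: for every $k>0$ and every multisubset $A$ of $[k]$ such that $\boldsymbol{s}\mapsto\Phi^{|A|}(\boldsymbol{s}|_A)$ is not constant on $S^k$, there is a unique subset (set) $A'\subseteq A$ with $\Phi^{|A|}(\boldsymbol{s}|_A)=\Phi^{|A'|}(\boldsymbol{s}|_{A'})$ for all $\boldsymbol{s}\in S^k$. Functionally representable: for every $k$ there is a partition $[k]=I\sqcup D$ and a map $\sigma\colon S^{|I|}\to S^{|D|}$ (dependency map) with $K_{\Phi^k}=\{(\boldsymbol{s}_I,\sigma(\boldsymbol{s}_I))\mid\boldsymbol{s}_I\in S^{|I|}\}$ ($\boldsymbol{s}_I$ placed on $I$, $\sigma(\boldsymbol{s}_I)$ on $D$). A decomposition of a hyperedge $e$ of a loopless hypergraph is $e=I\sqcup D$ with $\sigma\colon S^I\to S^D$ obtained from such data for $k=|e|$ via an enumeration of $e$. Contraction-closed: for every $k$, every $k'\ge k$ and every partition $[k]=I\sqcup D$ with a map $\sigma\colon S^{|I|}\to S^{|D|}$ satisfying $K_{\Phi^k}=\{(\boldsymbol{s}_I,\sigma(\boldsymbol{s}_I))\mid\boldsymbol{s}_I\in S^{|I|}\}$ ($\boldsymbol{s}_I$ placed on $I$, $\sigma(\boldsymbol{s}_I)$ on $D$), let $\hat\sigma\colon S^{[k']\setminus D}\to S^{[k']}$, $\hat\sigma(\boldsymbol{s})|_{[k']\setminus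 D}=\boldsymbol{s}$, $\hat\sigma(\boldsymbol{s})|_D=\sigma(\boldsymbol{s}|_I)$; then for every $A\subseteq[k']$ either $\Phi^{|A|}(\hat\sigma(\boldsymbol{s})|_A)$ is constant in $\boldsymbol{s}$, or there is a unique $A'\subseteq[k']\setminus D$ with $\Phi^{|A|}(\hat\sigma(\boldsymbol{s})|_A)=\Phi^{|A'|}(\boldsymbol{s}|_{A'})$ for all $\boldsymbol{s}\in S^{[k']\setminus D}$. Deletion and contraction. $G\setminus e=(V,E\setminus\{e\})$ and $\mathcal{M}\setminus e=\mathcal{M}(G\setminus e;\mathfrak{I})$. Given $e=I\sqcup D$ with $\sigma$, let $\hat\sigma\colon S^{V\setminus D}\to S^V$ be the identity on $V\setminus D$ and $\hat\sigma(\boldsymbol{s})|_D=\sigma(\boldsymbol{s}|_I)$. For $f\in E\setminus\{e\}$ let $\widetilde\phi^f(\boldsymbol{s})=\Phi^{|f|}(\hat\sigma(\boldsymbol{s})|_f)$, which depends only on $\boldsymbol{s}|_{(f\cup I)\setminus D}$. Set $f^*=\emptyset$ if $\widetilde\phi^f$ is constant; otherwise $f^*$ is the unique subset of $(f\cup I)\setminus D$ with $\widetilde\phi^f(\boldsymbol{s})=\Phi^{|f^*|}(\boldsymbol{s}|_{f^*})$ for all $\boldsymbol{s}$ (it exists and is unique by contraction-closedness). Then $G/_{\mathfrak{I},\sigma}e=(V\setminus D,\{f^*\mid f\in E\setminus\{e\}\})$, with hyperedge multiset indexed by $E\setminus\{e\}$ via $f\mapsto f^*$ (so $f^*$ carries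 the parameter $g_f$), and $\mathcal{M}/_{\mathfrak{I},\sigma}e=\mathcal{M}(G/_{\mathfrak{I},\sigma}e;\mathfrak{I})$. *)

(* Defs.v *)
From mathcomp Require Import all_boot all_order all_fingroup all_algebra.
From mathcomp Require Import finmap multiset.
From mathcomp Require Import all_classical all_reals all_analysis.
From mathcomp Require Import complex.

Set Implicit Arguments.
Unset Strict Implicit.
Unset Printing Implicit Defensive.

Import Order.TTheory GRing.Theory Num.Theory.
Import ComplexField.

Local Open Scope ring_scope.
Local Open Scope complex_scope.
Local Open Scope mset_scope.

(* exp (x + iy) = e^x (cos y + i sin y) *)
Definition cexp (R : realType) (z : R[i]) : R[i] :=
  let: x +i* y := z in (expR x * cos y) +i* (expR x * sin y).

Lemma cexp0 (R : realType) : cexp (0 : R[i]) = 1.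
Proof. by rewrite /cexp /= expR0 cos0 sin0 mulr1 mulr0. Qed.

Lemma cexpD (R : realType) (z w : R[i]) : cexp (z + w) = cexp z * cexp w.
Proof.
case: z w => [a b] [c d]; rewrite /cexp /= expRD cosD sinD.
apply/eqP; rewrite eq_complex /= !mulrBr !mulrDr; apply/andP; split; apply/eqP.
  by rewrite ![_ * cos b * _]mulrACA ![_ * sin b * _]mulrACA.
by rewrite ![_ * cos b * _]mulrACA ![_ * sin b * _]mulrACA addrC.
Qed.

(* S^A for a subset A of a finite index type T. *)
Notation cfg S A := {ffun {i | i \in A} -> S}.

Definition restr (S T : finType) (A : {set T}) (s : {ffun T -> S}) : cfg S A :=
  [ffun i => s (val i)].

Definition mset_of_set (T : finType) (A : {set T}) : {mset T} :=
  seq_mset (enum A).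

Definition constant_fun (X Y : Type) (f : X -> Y) : Prop :=
  forall x y, f x = f y.

(** Boolean interaction families *)

Record bool_interaction_family := BoolInteractionFamily {
  spin :> finType;
  card_spin : (1 < #|spin|)%N;
  Phi : forall k, {ffun 'I_k -> spin} -> bool;
  Phi_perm : forall k (p : 'S_k) (s : {ffun 'I_k -> spin}),
    Phi [ffun i => s (p i)] = Phi s
}.

Section Families.

Variable J : bool_interaction_family.

Definition Phi_seq (xs : seq J) : bool :=
  Phi [ffun i : 'I_(size xs) => tnth (in_tuple xs) i].

(* Phi^|A| (s|_A); the order in which A is enumerated is irrelevant by
   [Phi_perm]. *)
Definition Phi_at (T : finType) (A : {mset T}) (s : {ffun T -> J}) : bool :=
  Phi_seq [seq s i | i <- enum_mset A].

Definition loopblind : Prop :=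
  forall k (A : {mset 'I_k}), (0 < k)%N ->
    ~ constant_fun (fun s : {ffun 'I_k -> J} => Phi_at A s) ->
    exists! A' : {set 'I_k},
      {subset A' <= A} /\
      forall s : {ffun 'I_k -> J}, Phi_at A s = Phi_at (mset_of_set A') s.

End Families.

(** Dependency maps *)

(* Disjoint subsets I, D of T together with a map S^I -> S^D. *)
Record depmap (S T : finType) := DepMap {
  dep_I : {set T};
  dep_D : {set T};
  dep_disj : [disjoint dep_I & dep_D];
  dep_map :> cfg S dep_I -> cfg S dep_D
}.

Section DependencyMaps.

Variables (S T : finType).
Implicit Type d : depmap S T.

(* The index set T \ D. *)
Definition rest d : finType := {i : T | i \notin dep_D d}.

Definition rest_of_I d (i : {i | i \in dep_I d}) : rest d :=
  Sub (val i) (negbT (disjointFr (dep_disj d) (valP i))).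

(* sigma-hat : S^(T \ D) -> S^T *)
Definition hat d (s : {ffun rest d -> S}) : {ffun T -> S} :=
  [ffun i => match boolP (i \in dep_D d) with
             | AltTrue iD => d [ffun j => s (rest_of_I j)] (Sub i iD)
             | AltFalse iND => s (Sub i iND)
             end].

Variables (T' : finType) (eta : T -> T').

Lemma im_I d (i : {i | i \in dep_I d}) : eta (val i) \in eta @: dep_I d.
Proof. exact: imset_f (valP i). Qed.

Lemma im_D d (j : {j | j \in eta @: dep_D d}) :
  val j \in [seq eta i | i in dep_D d].
Proof. by have /imsetP[i iD ->] := valP j; exact: fintype.image_f. Qed.

Hypothesis eta_inj : injective eta.

Lemma im_disj d : [disjoint eta @: dep_I d & eta @: dep_D d].
Proof. by rewrite imset_disjoint ?dep_disj //; exact: in2W. Qed.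

(* Relabelling of the indices along an injection: (I, D, sigma) becomes
   (eta(I), eta(D), sigma) under the identifications I ~ eta(I), D ~ eta(D);
   [iinv] is the inverse of eta on eta(D). *)
Definition push d : depmap S T' :=
  DepMap (im_disj d)
    (fun s => [ffun j => d [ffun i => s (Sub (eta (val i)) (im_I i))]
                           (Sub (iinv (im_D j)) (mem_iinv (im_D j)))]).

End DependencyMaps.

Section FamilyConditions.

Variable J : bool_interaction_family.

(* [k] = I |_| D and K_{Phi^k} = {(s_I, sigma(s_I))}. *)
Definition represents k (d : depmap J 'I_k) : Prop :=
  dep_I d :|: dep_D d = [set: 'I_k] /\
  forall s : {ffun 'I_k -> J}, Phi s <->
    exists x : cfg J (dep_I d),
      restr (dep_I d) s = x /\ restr (dep_D d) s = d x.

Definition functionally_representable : Prop :=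
  forall k, exists d : depmap J 'I_k, represents d.

Lemma widen_inj k k' (le_kk' : (k <= k')%N) : injective (widen_ord le_kk').
Proof. by move=> i j /(congr1 val) /= ij; exact: val_inj. Qed.

Definition contraction_closed : Prop :=
  forall k k' (le_kk' : (k <= k')%N) (d0 : depmap J 'I_k),
    represents d0 ->
    let d := push (@widen_inj k k' le_kk') d0 in
    forall A : {set 'I_k'},
      constant_fun (fun s : {ffun rest d -> J} =>
                      Phi_at (mset_of_set A) (hat s)) \/
      exists! A' : {set rest d},
        forall s : {ffun rest d -> J},
          Phi_at (mset_of_set A) (hat s) = Phi_at (mset_of_set A') s.

End FamilyConditions.

(** Hypergraphs and models *)

(* The multiset of hyperedges is a family indexed by the finite type
   [edge G]. *)
Record hypergraph := Hypergraph {
  vertex : finType;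
  edge : finType;
  ends : edge -> {mset vertex}
}.

Definition loopless (G : hypergraph) : Prop :=
  forall (f : edge G) (v : vertex G), (ends f v <= 1)%N.

Record model (S : finType) := Model {
  model_vertex : finType;
  model_edge : finType;
  interaction : model_edge -> {ffun model_vertex -> S} -> bool
}.

Definition induced_model (J : bool_interaction_family) (G : hypergraph) : model J :=
  Model (fun (f : edge G) (s : {ffun vertex G -> J}) => Phi_at (ends f) s).

Definition Z (R : realType) (S : finType) (M : model S)
    (g : model_edge M -> R[i]) : R[i] :=
  \sum_(s : {ffun model_vertex M -> S})
    \prod_(f : model_edge M) cexp (g f * (interaction f s)%:R).

Definition deletion (G : hypergraph) (e : edge G) : hypergraph :=
  @Hypergraph (vertex G) {f : edge G | f != e} (fun f => ends (val f)).

Section Contraction.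

Variables (J : bool_interaction_family) (G : hypergraph).

(* eta enumerates the hyperedge e. *)
Definition decomposition (e : edge G) (d : depmap J (vertex G)) : Prop :=
  exists k (eta : 'I_k -> vertex G) (eta_inj : injective eta)
         (d0 : depmap J 'I_k),
    [/\ ends e = seq_mset [seq eta i | i <- enum 'I_k],
        represents d0
      & d = push eta_inj d0].

Variable d : depmap J (vertex G).

Definition phi_tilde (f : edge G) (s : {ffun rest d -> J}) : bool :=
  Phi_at (ends f) (hat s).

Definition is_fstar (f : edge G) (A : {set rest d}) : bool :=
  [forall v in A, (val v \in ends f) || (val v \in dep_I d)] &&
  [forall s, phi_tilde f s == Phi_at (mset_of_set A) s].

(* In the non-constant case, "the" set satisfying [is_fstar]; the default value
   is irrelevant for contraction-closed families. *)
Definition fstar (f : edge G) : {set rest d} :=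
  if [forall s, forall t, phi_tilde f s == phi_tilde f t] then finset.set0
  else odflt finset.set0 [pick A | is_fstar f A].

Definition contraction (e : edge G) : hypergraph :=
  @Hypergraph (rest d) {f : edge G | f != e}
    (fun f => mset_of_set (fstar (val f))).

End Contraction.

(* Main.v *)
Require Import Defs.
From mathcomp Require Import all_boot all_fingroup all_algebra.
From mathcomp Require Import finmap multiset.
From mathcomp Require Import reals complex.

Set Implicit Arguments.
Unset Strict Implicit.
Unset Printing Implicit Defensive.

Import GRing.Theory.
Local Open Scope ring_scope.
Local Open Scope complex_scope.

(** Since [Phi] is boolean, exp (g_e phi) = 1 + v_e [phi] for the interaction phi
    of e. Expanding this one factor writes Z as the partition function of the
    deletion plus v_e times the sum, over the configurations in which e is
    satisfied, of the product over the other hyperedges. Those configurations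
    are the solutions of the dependency map of e ([solves]), which sigma-hat
    parametrises bijectively by the configurations on V \ D ([sum_solves]), so
    the second sum becomes the partition function of the contraction as soon as
    the interaction of f^* at s equals that of f at sigma-hat(s) for every other
    hyperedge f ([Phi_at_fstar]).

    When that function of s is not constant, f^* exists by contraction-closedness
    ([is_fstar_exists]). The support condition on f^* comes for free if that
    hypothesis is applied to exactly the vertices of e and f, those of e listed
    first.

    When it is constant, f^* is empty and the interaction of f^* is Phi^0 = 1,
    so the constant must be shown to be 1 and not 0. This follows from a spin a
    such that Phi^k (a, ..., a) = 1 for all k ([saturated_spin]): the constant
    configuration a then solves the dependency map of e, so it is in the image
    of sigma-hat, and f is satisfied there.

    To find a, let Phi^1 (a) = 1, and let Phi^k be represented by I and D. If D
    is empty then Phi^k is identically 1. Otherwise put a spin x on I and a spin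
    y on D: Phi^k takes the value 1 exactly when y = tau x for
    some function tau ([two_block_Phi]). This is not constant, so loopblindness
    applied to |I| copies of one index and |D| copies of another identifies it
    with Phi^j for some j <= 2, and at x = y = a this reads
    Phi^k (a, ..., a) = Phi^j (a, ..., a). Only j = 2 needs work. There
    Phi^2 (x, y) = [y = tau x], and contracting one such pair against another
    gives equality of two spins, which has to be Phi^2 itself
    ([saturated_pair]). *)

(** * Interactions as functions of a list of spins *)

Lemma Phi_seq_nth (J : bool_interaction_family) k (xs : seq J) (x0 : J) :
  size xs = k -> Phi_seq xs = Phi [ffun i : 'I_k => nth x0 xs i].
Proof.
move=> <-; rewrite /Phi_seq; congr Phi; apply/ffunP => i.
by rewrite !ffunE (tnth_nth x0).
Qed.

Lemma Phi_seq_enum (J : bool_interaction_family) k (s : {ffun 'I_k -> J}) :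
  Phi_seq [seq s i | i <- enum 'I_k] = Phi s.
Proof.
have sz : size [seq s i | i <- enum 'I_k] = k by rewrite size_map size_enum_ord.
have /card_gt0P[x0 _] : (0 < #|{: J}|)%N by exact: ltnW (card_spin J).
rewrite (Phi_seq_nth x0 sz); congr Phi; apply/ffunP => i.
by rewrite ffunE (nth_map i) ?nth_ord_enum ?size_enum_ord.
Qed.

(** This is what makes [Phi_at] independent of the enumeration of its multiset. *)
Lemma Phi_seq_perm (J : bool_interaction_family) (xs ys : seq J) :
  perm_eq xs ys -> Phi_seq xs = Phi_seq ys.
Proof.
move=> xy; have /card_gt0P[x0 _] : (0 < #|{: J}|)%N by exact: ltnW (card_spin J).
rewrite (Phi_seq_nth x0 (perm_size xy)).
have /(@tuple_permP _ _ _ (in_tuple ys))[p ->] := xy.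
rewrite /Phi_seq -(Phi_perm p); congr Phi; apply/ffunP => i.
by rewrite !ffunE -tnth_nth tnth_mktuple.
Qed.

Lemma Phi_at_seq_mset (J : bool_interaction_family) (T : finType)
    (xs : seq T) (s : {ffun T -> J}) :
  Phi_at (seq_mset xs) s = Phi_seq [seq s i | i <- xs].
Proof. by apply/Phi_seq_perm/perm_map; rewrite perm_eq_seq_mset. Qed.

Lemma Phi_at_set_image (J : bool_interaction_family) (T T' : finType)
    (h : T -> T') (A : {set T}) (s : {ffun T' -> J}) : injective h ->
  Phi_at (mset_of_set (h @: A)) s = Phi_at (mset_of_set A) [ffun i => s (h i)].
Proof.
move=> h_inj; rewrite !Phi_at_seq_mset.
have -> : [seq [ffun i => s (h i)] i | i <- enum A] = [seq s i | i <- map h (enum A)].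
  by rewrite -map_comp; apply: eq_map => i /=; rewrite ffunE.
apply/Phi_seq_perm/perm_map/uniq_perm; rewrite ?enum_uniq ?map_inj_uniq ?enum_uniq //.
move=> y; rewrite mem_enum; apply/imsetP/mapP => -[x xA ->]; exists x => //.
  by rewrite mem_enum.
by rewrite mem_enum in xA.
Qed.

Lemma eq_Phi_at (J : bool_interaction_family) (T : finType) (A : {set T})
    (s t : {ffun T -> J}) : {in A, s =1 t} ->
  Phi_at (mset_of_set A) s = Phi_at (mset_of_set A) t.
Proof.
move=> st; rewrite !Phi_at_seq_mset; congr Phi_seq; apply/eq_in_map => i.
by rewrite mem_enum; apply: st.
Qed.

Lemma Phi_at_const (J : bool_interaction_family) (T : finType) (A : {set T}) (a : J) :
  Phi_at (mset_of_set A) [ffun=> a] = Phi_seq (nseq #|A| a).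
Proof.
rewrite Phi_at_seq_mset cardE; congr Phi_seq.
by elim: (enum A) => //= i r ->; rewrite ffunE.
Qed.

Lemma Phi_at_full (J : bool_interaction_family) k (s : {ffun 'I_k -> J}) :
  Phi_at (mset_of_set [set: 'I_k]) s = Phi s.
Proof. by rewrite Phi_at_seq_mset enum_setT -enumT Phi_seq_enum. Qed.

Lemma spin_neq (J : bool_interaction_family) (x : J) : exists y : J, y != x.
Proof.
have /card_gt0P[y] : (0 < #|predC1 x|)%N by rewrite cardC1 -subn1 subn_gt0 card_spin.
by exists y.
Qed.

(** * Configurations compatible with a dependency map *)

(** For a representing map of Phi^k these are the elements of K; unlike
    [represents] the condition is stable under relabelling ([push_solves]). *)
Definition solves (S T : finType) (d : depmap S T) (t : {ffun T -> S}) : bool :=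
  restr (dep_D d) t == d (restr (dep_I d) t).

(** The left inverse of [hat], and its inverse on the solutions. *)
Definition rest_cfg (S T : finType) (d : depmap S T) (t : {ffun T -> S}) :
  {ffun rest d -> S} := [ffun i => t (val i)].

Lemma hat_rest (S T : finType) (d : depmap S T) (s : {ffun rest d -> S}) (i : rest d) :
  hat s (val i) = s i.
Proof.
rewrite /hat ffunE; destruct (boolP (val i \in dep_D d)) as [iD|iD].
  by have := valP i; rewrite iD.
by congr (s _); apply: val_inj.
Qed.

Lemma hat_dep (S T : finType) (d : depmap S T) (s : {ffun rest d -> S})
    (i : {i | i \in dep_D d}) :
  hat s (val i) = d [ffun j => s (rest_of_I j)] i.
Proof.
rewrite /hat ffunE; destruct (boolP (val i \in dep_D d)) as [iD|iD].
  by congr (d _ _); apply: val_inj.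
by have := valP i; rewrite (negbTE iD).
Qed.

Lemma rest_cfgK (S T : finType) (d : depmap S T) (s : {ffun rest d -> S}) :
  rest_cfg d (hat s) = s.
Proof. by apply/ffunP => i; rewrite ffunE hat_rest. Qed.

Lemma hat_solves (S T : finType) (d : depmap S T) (s : {ffun rest d -> S}) :
  solves d (hat s).
Proof.
apply/eqP/ffunP => i; rewrite ffunE hat_dep; congr (d _ _).
by apply/ffunP => j; rewrite [LHS]ffunE [RHS]ffunE -hat_rest.
Qed.

Lemma solves_hat (S T : finType) (d : depmap S T) (t : {ffun T -> S}) :
  solves d t -> hat (rest_cfg d t) = t.
Proof.
move=> /eqP td; apply/ffunP => i; have [iD|iD] := boolP (i \in dep_D d).
  have /ffunP/(_ (Sub i iD)) := td; rewrite ffunE /= => ->.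
  by rewrite (hat_dep _ (Sub i iD)); congr (d _ _); apply/ffunP => j; rewrite !ffunE.
by rewrite (hat_rest _ (Sub i iD)) ffunE.
Qed.

Lemma push_solves (S T T' : finType) (h : T -> T') (h_inj : injective h)
    (d : depmap S T) (t : {ffun T' -> S}) :
  solves (push h_inj d) t = solves d [ffun i => t (h i)].
Proof.
have restrI : [ffun i : {i | i \in dep_I d} => restr (h @: dep_I d) t
                   (Sub (h (val i)) (im_I h i))]
              = restr (dep_I d) [ffun i => t (h i)].
  by apply/ffunP => i; rewrite !ffunE.
rewrite /solves /=; apply/eqP/eqP => td; apply/ffunP => i; rewrite !ffunE.
  have hiD : h (val i) \in h @: dep_D d by apply: imset_f (valP i).
  have /ffunP/(_ (Sub (h (val i)) hiD)) := td; rewrite !ffunE /= => ->.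
  rewrite restrI; congr (d _ _); apply: val_inj => /=.
  by apply: h_inj; rewrite f_iinv.
have /ffunP/(_ (Sub (iinv (im_D i)) (mem_iinv (im_D i)))) := td.
by rewrite !ffunE /= f_iinv restrI => ->.
Qed.

Lemma represents_solves (J : bool_interaction_family) k (d : depmap J 'I_k)
    (s : {ffun 'I_k -> J}) : represents d -> Phi s = solves d s.
Proof.
move=> [_ dP]; apply/idP/eqP => [/dP[x [<- ->]] //|sd].
by apply/dP; exists (restr (dep_I d) s).
Qed.

(** * A spin satisfying every interaction *)

(** The map [h] need not be injective: repeated indices give the loops that
    loopblindness speaks about. *)
Lemma Phi_at_image (J : bool_interaction_family) k (T : finType) (h : 'I_k -> T)
    (s : {ffun T -> J}) :
  Phi_at (seq_mset [seq h i | i <- enum 'I_k]) s = Phi [ffun i => s (h i)].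
Proof.
rewrite Phi_at_seq_mset -Phi_seq_enum -map_comp; congr Phi_seq.
by apply: eq_map => i /=; rewrite ffunE.
Qed.

Lemma Phi_const (J : bool_interaction_family) k (a : J) :
  Phi [ffun _ : 'I_k => a] = Phi_seq (nseq k a).
Proof. by rewrite -Phi_at_full Phi_at_const cardsT card_ord. Qed.

(** With x on I, the values forced on D all agree: exchanging two indices of D
    preserves the solution set by symmetry and does not touch I, on which the
    solution depends. The common value is tau x. *)
Lemma two_block_Phi (J : bool_interaction_family) k (d : depmap J 'I_k) :
  represents d -> dep_D d != finset.set0 ->
  exists tau : J -> J, forall x y,
    Phi [ffun i => if i \in dep_D d then y else x] = (y == tau x).
Proof.
move=> rep_d /finset.set0Pn[j jD]; have [IUD _] := rep_d.
have inI i : (i \in dep_I d) = (i \notin dep_D d).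
  apply/idP/idP => [iI|]; first by rewrite (disjointFr (dep_disj d) iI).
  by have := in_setT i; rewrite -IUD inE => /orP[|->].
pose t x := hat (d := d) [ffun=> x].
have t_out x i : i \notin dep_D d -> t x i = x.
  by move=> iD; rewrite /t (hat_rest _ (Sub i iD)) ffunE.
have t_in x i : i \in dep_D d -> t x i = t x j.
  move=> iD; pose t' := [ffun l => t x (tperm i j l)].
  have t'I : restr (dep_I d) t' = restr (dep_I d) (t x).
    apply/ffunP => l; rewrite !ffunE tpermD //; apply/eqP => lE;
      by have := valP l; rewrite inI -lE ?iD ?jD.
  have : Phi t' by rewrite Phi_perm (represents_solves _ rep_d) hat_solves.
  rewrite (represents_solves _ rep_d) => /eqP; rewrite t'I.
  have /eqP <- : solves d (t x) by exact: hat_solves.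
  by move=> /ffunP/(_ (Sub i iD)); rewrite [LHS]ffunE [RHS]ffunE ffunE tpermL.
exists (fun x => t x j) => x y; rewrite (represents_solves _ rep_d).
apply/eqP/eqP => [|->].
  have -> : restr (dep_I d) [ffun i => if i \in dep_D d then y else x]
            = restr (dep_I d) (t x).
    apply/ffunP => i; rewrite [LHS]ffunE [RHS]ffunE ffunE.
    by have := valP i; rewrite inI => iD; rewrite (negbTE iD) t_out.
  have /eqP <- : solves d (t x) by exact: hat_solves.
  by move=> /ffunP/(_ (Sub j jD)); rewrite [LHS]ffunE [RHS]ffunE ffunE jD.
suff -> : [ffun i => if i \in dep_D d then t x j else x] = t x.
  exact/eqP/hat_solves.
apply/ffunP => i; rewrite ffunE.
by case: ifPn => [iD|iD]; rewrite ?(t_in x i iD) ?(t_out x i iD).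
Qed.

(** By symmetry tau is an involution. Contracting the pair {0, 1} inside
    {0, 1, 2} turns the interaction of {1, 2} into s2 = tau (tau s0) = s0. This
    depends on both remaining indices, so the set given by
    contraction-closedness is {0, 2}, and Phi^2 (x, y) = [x = y]. *)
Lemma saturated_pair (J : bool_interaction_family) (tau : J -> J) (a : J) :
  contraction_closed J ->
  (forall s : {ffun 'I_2 -> J}, Phi s = (s ord_max == tau (s ord0))) ->
  Phi_seq (nseq 2 a).
Proof.
move=> closedJ PhiE.
have tauK x : tau (tau x) = x.
  pose s := [ffun i : 'I_2 => if i == ord0 then x else tau x].
  have : Phi [ffun i => s (tperm ord0 ord_max i)].
    by rewrite Phi_perm PhiE !ffunE.
  by rewrite PhiE !ffunE tpermL tpermR => /eqP.
have disj01 : [disjoint [set ord0 : 'I_2] & [set ord_max : 'I_2]].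
  by rewrite disjoints1 inE.
pose d0 : depmap J 'I_2 :=
  DepMap disj01 (fun c => [ffun=> tau (c (Sub ord0 (set11 ord0)))]).
have d0_solves s : solves d0 s = (s ord_max == tau (s ord0)).
  apply/eqP/eqP => [/ffunP/(_ (Sub ord_max (set11 ord_max)))|E].
    by rewrite !ffunE.
  by apply/ffunP => i; rewrite !ffunE /= -E; have /set1P-> := valP i.
have rep_d0 : represents d0.
  split; first by apply/setP => -[[|[|]]] // ?; rewrite !inE.
  move=> s; rewrite PhiE -d0_solves; split=> [/eqP E|[x [<- E]]].
    by exists (restr (dep_I d0) s).
  exact/eqP.
(* h embeds the pair as {1, 2}, so its image meets {0, 1} in the dependent index 1. *)
pose h := lift (ord0 : 'I_3).
have h_inj : injective h := @lift_inj 3 ord0.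
have le23 : (2 <= 3)%N by [].
have := closedJ 2 3 le23 d0 rep_d0.
set d := push _ d0.
move=> /(_ (h @: [set: 'I_2])).
have value u : Phi_at (mset_of_set (h @: [set: 'I_2])) (hat (d := d) u)
               = (hat u ord_max == hat u ord0).
  move: (hat u) (hat_solves u) => t.
  rewrite push_solves d0_solves !ffunE => /eqP t1.
  rewrite Phi_at_set_image // Phi_at_full PhiE !ffunE.
  have -> : h ord_max = ord_max by apply: val_inj.
  have -> : t (h ord0) = tau (t ord0).
    have -> : h ord0 = widen_ord le23 ord_max by apply: val_inj.
    by rewrite t1; congr (tau (t _)); apply: val_inj.
  by rewrite tauK.
have dD i : (i \in dep_D d) = (val i == 1%N).
  apply/imsetP/eqP => [[l /set1P-> ->] //|i1].
  by exists ord_max; rewrite ?set11 //; apply: val_inj.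
have r0P : (ord0 : 'I_3) \notin dep_D d by rewrite dD.
have r2P : (ord_max : 'I_3) \notin dep_D d by rewrite dD.
pose r0 : rest d := Sub ord0 r0P; pose r2 : rest d := Sub ord_max r2P.
have {}value u : Phi_at (mset_of_set (h @: [set: 'I_2])) (hat (d := d) u)
                 = (u r2 == u r0).
  by rewrite value -(hat_rest u r0) -(hat_rest u r2).
have [y y_neq] := spin_neq a.
(* Changing the constant configuration at r alone destroys s2 = s0, hence r is in A'. *)
pose bump r : {ffun rest d -> J} := [ffun i => if i == r then y else a].
have bumpE r : r = r0 \/ r = r2 -> (bump r r2 == bump r r0) = false.
  by case=> ->; rewrite !ffunE /=; apply/negbTE; rewrite // eq_sym.
case=> [A_const|[A' [A'P _]]].
  have := A_const [ffun=> a] (bump r0); rewrite !value bumpE; last by left.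
  by rewrite !ffunE eqxx.
have in_A' r : r = r0 \/ r = r2 -> r \in A'.
  move=> rE; apply: contraFT (bumpE r rE) => rA'.
  have -> : bump r r2 == bump r r0 = ([ffun=> a] r2 == [ffun=> a] r0 :> J).
    rewrite -!value !A'P; apply: eq_Phi_at => i iA'.
    by rewrite !ffunE; case: eqP => // ir; rewrite -ir iA' in rA'.
  by rewrite !ffunE.
have A'E : A' = [set r0; r2].
  apply/setP => r; rewrite !inE; apply/idP/orP; last first.
    by case=> /eqP->; apply: in_A'; [left|right].
  move=> _; have := valP r; rewrite dD; case rE: (val (val r)) => [|[|[|n]]] // _.
  - by left; apply/eqP; do 2!apply: val_inj.
  - by right; apply/eqP; do 2!apply: val_inj.
  - by have := ltn_ord (val r); rewrite rE.
have <- : #|A'| = 2%N by rewrite A'E cards2.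
by rewrite -Phi_at_const -A'P value !ffunE.
Qed.

Lemma saturated_spin (J : bool_interaction_family) :
  loopblind J -> functionally_representable J -> contraction_closed J ->
  exists a : J, forall k, Phi_seq (nseq k a).
Proof.
move=> loopJ repJ closedJ.
have Phi_exists k : exists s : {ffun 'I_k -> J}, Phi s.
  have [d rep_d] := repJ k.
  have /card_gt0P[x _] : (0 < #|{: J}|)%N by exact: ltnW (card_spin J).
  by exists (hat (d := d) [ffun=> x]); rewrite (represents_solves _ rep_d) hat_solves.
have [s1 s1P] := Phi_exists 1%N; pose a := s1 ord0.
have sat0 : Phi_seq (nseq 0 a).
  have [s sP] := Phi_exists 0%N; rewrite -Phi_const.
  by have -> : [ffun=> a] = s by apply/ffunP => -[].
have sat1 : Phi_seq (nseq 1 a).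
  rewrite -Phi_const; have -> // : [ffun=> a] = s1.
  by apply/ffunP => i; rewrite ffunE /a (ord1 i).
exists a => k; have [d rep_d] := repJ k.
have [D0|D_neq0] := eqVneq (dep_D d) finset.set0.
  rewrite -Phi_const (represents_solves _ rep_d); apply/eqP/ffunP => i.
  have : val i \in finset.set0 by rewrite -D0; apply: valP i.
  by rewrite inE.
have [tau tauP] := two_block_Phi rep_d D_neq0.
(* Sends I to the first of two indices and D to the second. *)
pose block i : 'I_2 := if i \in dep_D d then ord_max else ord0.
pose A := seq_mset [seq block i | i <- enum 'I_k].
have AE s : Phi_at A s = (s ord_max == tau (s ord0)).
  rewrite Phi_at_image -tauP; congr Phi; apply/ffunP => i.
  by rewrite !ffunE /block; case: ifP.
have A_nonconst : ~ constant_fun (fun s : {ffun 'I_2 -> J} => Phi_at A s).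
  move=> A_const; have [y y_neq] := spin_neq (tau a).
  have := A_const [ffun i => if i == ord0 then a else tau a]
                  [ffun i => if i == ord0 then a else y].
  by rewrite !AE !ffunE /= eqxx (negbTE y_neq).
have [A' [[_ A'P] _]] := loopJ 2 A isT A_nonconst.
have -> : Phi_seq (nseq k a) = Phi_seq (nseq #|A'| a).
  rewrite -Phi_at_const -A'P Phi_at_image -Phi_const.
  by congr Phi; apply/ffunP => i; rewrite !ffunE.
have : (#|A'| <= 2)%N by rewrite -[X in (_ <= X)%N]card_ord max_card.
case cardA': #|A'| => [|[|[|//]]] _ //.
have A'T : A' = [set: 'I_2].
  by apply/eqP; rewrite finset.eqEcard subsetT cardsT card_ord cardA'.
apply: (@saturated_pair _ tau) => // s.
by rewrite -AE A'P A'T Phi_at_full.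
Qed.

(** * Contracted hyperedges *)

Lemma decomposition_solves (J : bool_interaction_family) (G : hypergraph)
    (e : edge G) (d : depmap J (vertex G)) (t : {ffun vertex G -> J}) :
  decomposition e d -> Phi_at (ends e) t = solves d t.
Proof.
move=> [k [eta [eta_inj [d0 [-> rep_d0 ->]]]]].
by rewrite Phi_at_image push_solves (represents_solves _ rep_d0).
Qed.

Lemma loopless_ends (G : hypergraph) (f : edge G) : loopless G ->
  ends f = mset_of_set [set v in ends f].
Proof.
move=> loopG; apply/msetP => v; rewrite mset_seqE count_uniq_mem ?enum_uniq //.
by rewrite mem_enum inE in_mset; case: (ends f v) (loopG f v) => [|[|]].
Qed.

(** Contraction-closedness is stated over [k'] with the contracted hyperedge in
    first position, so the vertices are relabelled by an enumeration theta of
    e followed by f \ e. Since theta reaches no other vertex, any set of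
    independent indices automatically lies in (f union I) \ D. *)
Lemma is_fstar_exists (J : bool_interaction_family) (G : hypergraph)
    (e f : edge G) (d : depmap J (vertex G)) :
  contraction_closed J -> loopless G -> decomposition e d ->
  ~ constant_fun (@phi_tilde J G d f) -> exists A : {set rest d}, is_fstar f A.
Proof.
move=> closedJ loopG [k [eta [eta_inj [d0 [_ rep_d0 dE]]]]] f_nonconst.
pose F := [set v in ends f].
pose vs := [seq eta i | i <- enum 'I_k] ++ enum (F :\: [set eta i | i : 'I_k]).
have vs_uniq : uniq vs.
  rewrite cat_uniq map_inj_uniq // !enum_uniq andbT; apply/hasPn => v.
  rewrite mem_enum inE => /andP[/imsetP eta_v _]; apply/mapP => -[i _ vE].
  by apply: eta_v; exists i.
pose theta i := tnth (in_tuple vs) i.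
have theta_inj : injective theta by apply/tuple_uniqP.
have le_k : (k <= size vs)%N by rewrite size_cat size_map size_enum_ord leq_addr.
have theta_eta i : theta (widen_ord le_k i) = eta i.
  rewrite /theta (tnth_nth (eta i)) nth_cat size_map size_enum_ord /= ltn_ord.
  by rewrite (nth_map i) ?nth_ord_enum ?size_enum_ord.
pose d1 := push (@widen_inj _ _ le_k) d0.
have theta_solves t : solves d t -> solves d1 [ffun i => t (theta i)].
  rewrite dE !push_solves; congr (solves d0 _).
  by apply/ffunP => i; rewrite !ffunE theta_eta.
have theta_D i : (theta i \in dep_D d) = (i \in dep_D d1).
  rewrite dE -(mem_imset _ _ theta_inj) /= -imset_comp.
  by rewrite (eq_imset (g := eta)) // => j /=; rewrite theta_eta.
have theta_restP (i : rest d1) : theta (val i) \notin dep_D d.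
  by rewrite theta_D (valP i).
pose theta_rest (i : rest d1) : rest d := Sub (theta (val i)) (theta_restP i).
have theta_rest_inj : injective theta_rest.
  by move=> i j /(congr1 val)/theta_inj/val_inj.
pose A1 := theta @^-1: F.
have FE : theta @: A1 = F.
  apply/setP => v; apply/imsetP/idP => [[i iA1 ->]|vF]; first by rewrite inE in iA1.
  have /tnthP[i vE] : v \in in_tuple vs.
    rewrite mem_cat mem_enum finset.in_setD vF andbT.
    by case: imsetP => [[i _ ->]|]; rewrite ?orbT ?map_f ?mem_enum.
  by exists i => //; move: vF; rewrite vE !inE.
(* The relabelling by theta commutes with sigma-hat. *)
have transport (s : {ffun rest d -> J}) :
    phi_tilde f s = Phi_at (mset_of_set A1)
                                   (hat (d := d1) [ffun i => s (theta_rest i)]).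
  rewrite /phi_tilde (loopless_ends _ loopG) -/F -FE Phi_at_set_image //.
  rewrite -[X in Phi_at _ X](solves_hat (theta_solves _ (hat_solves s))).
  congr (Phi_at _ (hat _)); apply/ffunP => i.
  by rewrite [RHS]ffunE -(hat_rest s) [LHS]ffunE [LHS]ffunE.
case: (closedJ _ _ le_k d0 rep_d0 A1) => [A1_const|[A2 [A2P _]]].
  by case: f_nonconst => s s'; rewrite !transport; apply: A1_const.
exists (theta_rest @: A2); apply/andP; split.
  apply/forall_inP => _ /imsetP[i _ ->]; rewrite /=.
  have := mem_tnth (val i) (in_tuple vs); rewrite -/(theta (val i)) mem_cat mem_enum.
  case/orP=> [/mapP[j _ jE]|]; last by rewrite !inE => /andP[_ ->].
  have [IUD _] := rep_d0; have := in_setT j; rewrite -IUD inE => /orP[jI|jD].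
    by rewrite jE dE imset_f ?orbT.
  by have := theta_restP i; rewrite jE dE imset_f.
by apply/forallP => s; rewrite transport A2P Phi_at_set_image.
Qed.

(** In the constant case the configuration equal to a saturated spin shows that
    the constant is 1, the value of Phi^0. *)
Lemma Phi_at_fstar (J : bool_interaction_family) (G : hypergraph)
    (e f : edge G) (d : depmap J (vertex G)) (s : {ffun rest d -> J}) :
  loopblind J -> functionally_representable J -> contraction_closed J ->
  loopless G -> decomposition e d ->
  Phi_at (mset_of_set (fstar d f)) s = Phi_at (ends f) (hat s).
Proof.
move=> loopJ repJ closedJ loopG dec_e; rewrite /fstar -/(phi_tilde f s).
have [a sat_a] := saturated_spin loopJ repJ closedJ.
case: ifP => [/forallP f_const|/negbT f_nonconst].
  have const_hat : hat (d := d) [ffun=> a] = [ffun=> a].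
    have a_solves : solves d [ffun=> a].
      rewrite -(decomposition_solves _ dec_e).
      have [k [eta [_ [d0 [-> _ _]]]]] := dec_e.
      rewrite Phi_at_image; have := sat_a k; rewrite -Phi_const.
      congr (is_true (Phi _)).
      by apply/ffunP => i; rewrite !ffunE.
    rewrite -[RHS](solves_hat a_solves); congr hat.
    by apply/ffunP => i; rewrite !ffunE.
  have /forallP/(_ [ffun=> a])/eqP -> := f_const s.
  rewrite /phi_tilde const_hat (loopless_ends _ loopG) Phi_at_const sat_a.
  by rewrite Phi_at_seq_mset finset.enum_set0 /= (sat_a 0%N).
case: pickP => [A /andP[_ /forallP/(_ s)/eqP->] //|no_fstar].
have [|A] := is_fstar_exists (f := f) closedJ loopG dec_e.
  move=> f_const; case/negP: f_nonconst.
  by apply/forallP => s1; apply/forallP => s2; apply/eqP/f_const.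
by rewrite no_fstar.
Qed.

(** * Expanding one hyperedge *)

Lemma cexp_bool (R : realType) (z : R[i]) (b : bool) :
  cexp (z * b%:R) = 1 + (cexp z - 1) * b%:R.
Proof. by case: b; rewrite ?mulr1 ?mulr0 ?cexp0 ?addr0 // addrC subrK. Qed.

Lemma sum_solves (S T : finType) (V : nmodType) (d : depmap S T)
    (F : {ffun T -> S} -> V) :
  \sum_(t | solves d t) F t = \sum_(s : {ffun rest d -> S}) F (hat s).
Proof.
rewrite (reindex_onto (@hat S T d) (@rest_cfg S T d)) => [|t]; last exact: solves_hat.
by apply: eq_bigl => s; rewrite hat_solves rest_cfgK eqxx.
Qed.

Unset Implicit Arguments.
Set Strict Implicit.

Theorem corollary3p23 (R : realType) (J : bool_interaction_family)
    (J_loopblind : loopblind J)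
    (J_representable : functionally_representable J)
    (J_contraction_closed : contraction_closed J)
    (G : hypergraph) (G_loopless : loopless G)
    (e : edge G) (d : depmap J (vertex G)) (e_dec : decomposition e d)
    (g : edge G -> R[i]) :
  let g' := fun f : {f : edge G | f != e} => g (val f) in
  let v_e := cexp (g e) - 1 in
  Z (M := induced_model J G) g =
    Z (M := induced_model J (deletion e)) g'
    + v_e * Z (M := induced_model J (contraction d e)) g'.
Proof.
move=> g' v_e; rewrite /Z /=.
pose W (s : {ffun vertex G -> J}) :=
  \prod_(f : {f : edge G | f != e}) cexp (g' f * (Phi_at (ends (val f)) s)%:R).
have split_e (s : {ffun vertex G -> J}) :
    \prod_f cexp (g f * (Phi_at (ends f) s)%:R) = W s + v_e * ((solves d s)%:R * W s).
  rewrite (bigD1 e) //= (big_sub [pred f | f != e]) /= cexp_bool.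
  by rewrite (decomposition_solves s e_dec) mulrDl mul1r -mulrA.
rewrite (eq_bigr _ (fun s _ => split_e s)) big_split -mulr_sumr; congr (_ + _ * _).
transitivity (\sum_(s | solves d s) W s).
  rewrite [RHS]big_mkcond; apply: eq_bigr => s _.
  by case: solves; rewrite ?mul1r ?mul0r.
rewrite sum_solves; apply: eq_bigr => s _; apply: eq_bigr => f _.
by rewrite (Phi_at_fstar (e := e)).
Qed.
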